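(* Let $d=(d_1,\ldots,d_n)$ be a non-increasing sequence of positive integers such that $d_1\geq 2$ and $\sum_{i=1}^n d_i=2n-2c$ for some positive integer $c$. Then $$ \gamma_{\max}^{\mathcal F}(d)= \begin{cases} n-n_1(d)+c-1, & \text{if } n_1(d)>n_{\geq 2}(d) \text{ and } c-1<\left\lceil\frac{n_1(d)-n_{\geq 2}(d)}{2}\right\rceil,\\[2mm] \left\lfloor\frac{n}{2}\right\rfloor, & \text{if } n_1(d)>n_{\geq 2}(d) \text{ and } c-1\geq \left\lceil\frac{n_1(d)-n_{\geq 2}(d)}{2}\right\rceil,\\[2mm] \left\lceil\frac{n+n_1(d)-2}{3}\right\rceil, & \text{if } n_1(d)\leq n_{\geq 2}(d). \end{cases} $$
   Context: All graphs are finite, simple and undirected. For a sequence $d$ of non-negative integers, $\mathcal F(d)$ denotes the set of all forests whose degree sequence is $d$, and $\gamma_{\max}^{\mathcal F}(d)=\max\{\gamma(F):F\in\mathcal F(d)\}$, where $\gamma(F)$ is the domination number of $F$ (the minimum cardinality of a set $D$ of vertices such that every vertex not in $D$ has a neighbor in $D$). For an integer $i\ge 0$, $n_i(d)$ and $n_{\geq i}(d)$ denote the number of entries of $d$ equal to $i$ and at least $i$, respectively. (A sequence of positive integers with sum $2n-2c$, $c\ge1$, is the degree sequence of a forest, and every such forest has exactly $c$ components.) *)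

(* Defs.v *)
From mathcomp Require Import all_boot.

Set Implicit Arguments.
Unset Strict Implicit.
Unset Printing Implicit Defensive.

Record sgraph := SGraph {
  vertex :> finType;
  edge : rel vertex;
  edge_sym : symmetric edge;
  edge_irrefl : irreflexive edge
}.

Definition degree (G : sgraph) (v : G) : nat := #|[set w | edge v w]|.

(* A cycle of a simple graph has length at least 3; in the sense of [ucycle],
   every edge also yields a cycle of length 2. *)
Definition is_forest (G : sgraph) : Prop :=
  forall s : seq G, 3 <= size s -> ~ ucycle (@edge G) s.

Definition dominating (G : sgraph) (D : {set G}) : bool :=
  [forall v, (v \notin D) ==> [exists w in D, edge v w]].

(* The default value [set: G] of the arg min is itself dominating. *)
Definition domination_number (G : sgraph) : nat :=
  #|[arg min_(D < [set: G] | dominating D) #|D|]|.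

(* Degree sequences are compared up to reordering of the vertices. *)
Definition forest_realization (d : seq nat) (G : sgraph) : Prop :=
  is_forest G /\ perm_eq [seq degree v | v : G] d.

(* [is_gamma_max_forest d m]: the maximum of the domination number over all
   forests with degree sequence [d] exists and equals [m].  It is a relation
   because the forests range over all finite vertex types. *)
Definition is_gamma_max_forest (d : seq nat) (m : nat) : Prop :=
  (exists2 F : sgraph, forest_realization d F & domination_number F = m) /\
  (forall F : sgraph, forest_realization d F -> domination_number F <= m).

Definition num_eq (i : nat) (d : seq nat) : nat := count (pred1 i) d.

Definition num_ge (i : nat) (d : seq nat) : nat := count (fun x => i <= x) d.

Definition ceil_div (m k : nat) : nat := (m + k.-1) %/ k.

(* Main.v *)
(* Upper bounds. Let [m] be the number of inner vertices and [n1] that of leaves.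
   Without isolated vertices the complement of a minimum dominating set dominates,
   so [2 gamma <= n]. All inner vertices together with one vertex of each
   K2-component dominate, and there are at most [c - 1] such components. Finally a
   forest has a proper 3-colouring in which every inner vertex sees both other
   colours; a colour class, completed by the leaves it misses, dominates, and the
   three completed classes have total size [n + n1], so [3 gamma <= n + n1].

   Lower bounds. A set of vertices with pairwise disjoint closed neighbourhoods has
   size at most [gamma]. If there are at least [m] leaves, some tree gives each
   inner vertex its own leaf, and these [m] leaves form such a set. Surplus leaves
   are used up in K2-components. If there are fewer than [m] leaves, then many
   degrees equal 2: they are spent on P4-components and on subdividing an edge,
   where three subdivisions increase the packing by one. *)

Require Import Defs.
From mathcomp Require Import all_boot.
From mathcomp Require Import zify.

Set Implicit Arguments.
Unset Strict Implicit.
Unset Printing Implicit Defensive.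

(** * Domination and packings in arbitrary graphs *)

Definition packing (G : sgraph) (P : {set G}) : Prop :=
  forall x y w, x \in P -> y \in P ->
    (w == x) || edge x w -> (w == y) || edge y w -> x = y.

Section UpperBounds.
Variable G : sgraph.
Implicit Types (A D P : {set G}) (u v w : G).

Lemma domination_number_le D : dominating D -> domination_number G <= #|D|.
Proof.
rewrite /domination_number; case: arg_minnP => [|D0 _ minD]; last exact: minD.
by apply/forallP => v; rewrite inE.
Qed.

Lemma domination_number_attained :
  exists2 D : {set G}, dominating D & #|D| = domination_number G.
Proof.
rewrite /domination_number; case: arg_minnP => [|D0 domD _]; last by exists D0.
by apply/forallP => v; rewrite inE.
Qed.

Lemma dominatingP D :
  reflect (forall v, v \notin D -> exists2 w, w \in D & edge v w) (dominating D).
Proof.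
apply: (iffP forallP) => [domD v vD | domD v].
  by move: (domD v); rewrite vD => /existsP[w /andP[wD vw]]; exists w.
by apply/implyP => /domD [w wD vw]; apply/existsP; exists w; rewrite wD.
Qed.

Lemma degree_gt0P v : reflect (exists w, edge v w) (0 < degree v).
Proof.
by apply: (iffP card_gt0P) => -[w]; [rewrite inE | move=> vw]; exists w; rewrite ?inE.
Qed.

Lemma degree1_uniq v w w' : degree v = 1 -> edge v w -> edge v w' -> w = w'.
Proof.
move=> /eqP/cards1P[z Ez] vw vw'.
have := in_set1 w z; have := in_set1 w' z.
by rewrite -Ez !inE vw vw' => /esym/eqP-> /esym/eqP->.
Qed.

Lemma degree_ge2P v :
  reflect (exists w w', [/\ edge v w, edge v w' & w != w']) (1 < degree v).
Proof.
apply: (iffP card_gt1P) => [[w [w' [vw vw' ne]]]|[w [w' [vw vw' ne]]]];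
  exists w, w'; move: vw vw'; rewrite ?inE //.
Qed.

(* Ore's bound. *)
Lemma domination_number_half :
  (forall v, 0 < degree v) -> 2 * domination_number G <= #|G|.
Proof.
move=> pos; have [D domD cD] := domination_number_attained.
suff domC : dominating (~: D).
  have := domination_number_le domC; rewrite -cD; have := cardsC D; lia.
apply/dominatingP => v; rewrite inE negbK => vD.
case: (pickP [pred w | edge v w & w \notin D]) => [w /andP[vw wD]|noD].
  by exists w; rewrite ?inE.
have domDv : dominating (D :\ v).
  apply/dominatingP => w; rewrite !inE negb_and negbK => /orP[/eqP->|wD].
    have /degree_gt0P[u vu] := pos v; exists u => //.
    rewrite !inE; have := noD u; rewrite /= vu /= => /negbT; rewrite negbK => ->.
    by rewrite andbT; apply: contraTneq vu => ->; rewrite edge_irrefl.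
  have /dominatingP/(_ w wD)[u uD wu] := domD; exists u => //.
  rewrite !inE uD andbT; apply: contraTneq wu => ->.
  by have := noD w; rewrite /= wD andbT edge_sym => ->.
have := domination_number_le domDv; rewrite -cD (cardsD1 v D) vD; lia.
Qed.

(** A dominating set meets the closed neighbourhood of every packing vertex, and disjointness makes
    the choice of a common vertex injective. *)
Lemma packing_le_domination_number P : packing P -> #|P| <= domination_number G.
Proof.
move=> packP; have [D /dominatingP domD <-] := domination_number_attained.
pose f x := odflt x [pick w in D | (w == x) || edge x w].
have fP x : f x \in D /\ ((f x == x) || edge x (f x)).
  rewrite /f; case: pickP => [w /andP[]//|noD] /=.
  have [xD|/domD[w wD xw]] := boolP (x \in D).
    by have := noD x; rewrite xD eqxx.
  by have := noD w; rewrite wD xw orbT.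
rewrite -(@card_in_imset _ _ f) => [|x y xP yP Exy].
  by apply/subset_leq_card/subsetP => _ /imsetP[x _ ->]; case: (fP x).
by apply: (packP x y (f x)) => //; [|rewrite Exy]; case: (fP x); case: (fP y).
Qed.

(** * Upper bounds for forests *)

Hypothesis forestG : is_forest G.

(** If every vertex of [A] had two neighbours in [A], a simple path could be prolonged at its head
    forever: a head whose neighbours all lie on the path would close a cycle. *)
Lemma forest_low_degree A : A != set0 ->
  exists2 v, v \in A & #|[set w in A | edge v w]| <= 1.
Proof.
case/set0Pn => a aA.
case: (pickP [pred v in A | #|[set w in A | edge v w]| <= 1]) => [v /andP[]|noA].
  by exists v.
have two x : x \in A -> exists y z, [/\ y \in A, z \in A, edge x y, edge x z & y != z].
  move=> xA; have := noA x; rewrite /= xA /= => /negbT; rewrite -ltnNge.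
  by case/card_gt1P => y [z [/setIdP[yA xy] /setIdP[zA xz] ne]]; exists y, z.
suff longpath k : exists x s, [/\ x \in A, path (@edge G) x s, uniq (x :: s) & size s = k].
  have [x [s [_ _ us ss]]] := longpath #|G|.
  by have := max_card [in x :: s]; rewrite (card_uniqP us) /= ss ltnn.
elim: k => [|k [x [s [xA ps us ss]]]]; first by exists a, [::].
have ext y : y \in A -> edge x y -> y \notin x :: s -> exists x s,
    [/\ x \in A, path (@edge G) x s, uniq (x :: s) & size s = k.+1].
  move=> yA xy ys; exists y, (x :: s); split => //=; last by rewrite ss.
    by rewrite edge_sym xy.
    exact: (introT andP (conj ys us)).
have [y [z [yA zA xy xz yz]]] := two x xA.
have [ys|ys] := boolP (y \in x :: s); last exact: (ext y).
have [zs|zs] := boolP (z \in x :: s); last exact: (ext z).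
move=> {ext}.
have nx t : edge x t -> (t == x) = false.
  by move=> xt; apply: contraTF xt => /eqP->; rewrite edge_irrefl.
move: ys zs; rewrite !inE !nx //= => ys zs.
case: s ps us ss ys zs => [|h s] //= /andP[xh ps] us _; rewrite !inE => yh zh.
(* One of the two neighbours of the head [x] lies beyond the second vertex [h]; the edge from it to
   [x] closes a cycle of length at least 3. *)
have [t xt ts] : exists2 t, edge x t & t \in s.
  case: (y =P h) yh => [Ey|_ /=]; last by exists y.
  by move: zh; rewrite -Ey eq_sym (negPf yz) => zs; exists z.
case/splitPr: ts ps us => p1 p2.
rewrite cat_path => /and3P[pp1 lt _].
rewrite -cat_rcons -!cat_cons cat_uniq /= => us.
case: (@forestG (x :: h :: rcons p1 t)); first by rewrite /= size_rcons.
rewrite /ucycle /= rcons_path last_rcons rcons_path xh pp1 lt edge_sym xt /=.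
by case/and5P: us; rewrite !inE !mem_cat !negb_or => /and3P[-> -> _] /andP[-> _] ->.
Qed.

(** Induction runs over vertex subsets instead of subforests, so the ambient graph and its degrees
    stay fixed. *)
Lemma forest_ind (Q : {set G} -> Prop) :
  Q set0 ->
  (forall A v, v \notin A -> #|[set w in A | edge v w]| <= 1 -> Q A -> Q (v |: A)) ->
  forall A, Q A.
Proof.
move=> Q0 QS A; move: {2}#|A| (erefl #|A|) => k; elim: k A => [|k IHk] A cA.
  by rewrite (cards0_eq cA).
have /forest_low_degree[v vA low] : A != set0 by rewrite -card_gt0 cA.
rewrite -(setD1K vA); apply: QS; first by rewrite !inE eqxx.
  apply: leq_trans low; apply/subset_leq_card/subsetP => w.
  by rewrite !inE => /andP[/andP[_ ->]].
by apply: IHk; move: cA; rewrite (cardsD1 v) vA => -[].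
Qed.

(** Each vertex added by [forest_ind] brings at most one edge, which the double sum counts twice,
    and the first vertex brings none. *)
Lemma forest_edges A : A != set0 ->
  \sum_(x in A) \sum_(w in A) edge x w + 2 <= 2 * #|A|.
Proof.
elim/forest_ind: A => [|A v vA low IH _]; first by rewrite eqxx.
have cv : \sum_(w in A) edge v w = #|[set w in A | edge v w]|.
  rewrite -sum1_card big_mkcond [RHS]big_mkcond; apply: eq_bigr => w _.
  by rewrite inE; case: (w \in A); case: (edge v w).
rewrite big_setU1 //= big_setU1 //= edge_irrefl.
under [X in _ + X + _]eq_bigr => x _ do rewrite big_setU1 //= edge_sym.
rewrite big_split /= cardsU1 vA cv /=.
have [A0|/IH] := eqVneq A set0; last lia.
by move: cv; rewrite A0 !big_set0 cards0 => <-.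
Qed.

(** A closed set is a union of components, so its degrees count only edges inside it. *)
Lemma forest_sum_degree_closed A : A != set0 ->
  (forall v w, v \in A -> edge v w -> w \in A) ->
  \sum_(v in A) degree v + 2 <= 2 * #|A|.
Proof.
move=> A0 closedA; apply: leq_trans (forest_edges A0).
rewrite leq_add2r leq_sum // => v vA.
rewrite /degree -sum1_card big_mkcond [X in _ <= X]big_mkcond leq_sum // => w _.
by rewrite inE; case vw : (edge v w) => //=; rewrite (closedA v w vA vw).
Qed.

(* Take all vertices of degree at least 2 and one vertex of each K2-component;
   deleting the K2-components from the forest bounds their number. *)
Lemma domination_number_inner c :
  (forall v : G, 0 < degree v) -> (exists v : G, 1 < degree v) ->
  \sum_(v : G) degree v + 2 * c = 2 * #|G| ->
  domination_number G + 1 <= #|[set v : G | 1 < degree v]| + c.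
Proof.
move=> pos [v0 v0inner] sum_deg.
pose K := [set v : G | (degree v == 1) && [exists w, edge v w && (degree w == 1)]].
have partner v w : v \in K -> edge v w -> degree w = 1.
  rewrite inE => /andP[/eqP d1 /existsP[u /andP[vu /eqP du]]] vw.
  by rewrite (degree1_uniq d1 vw vu).
(* With S the degree sum outside [K], #|K| + S = 2 * #|G| - 2 * c, while S is at most 2 * (#|G| -
   #|K|) - 2. *)
have cardK : #|K| + 2 <= 2 * c.
  have AK : ~: K != set0.
    by apply/set0Pn; exists v0; rewrite !inE; case: eqP v0inner => // ->.
  have := forest_sum_degree_closed AK; have := cardsC K.
  move: sum_deg; rewrite (bigID (mem K)) /=.
  rewrite (eq_bigr (fun=> 1)) ?sum1_card => [|v]; last first.
    by rewrite inE => /andP[/eqP].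
  rewrite (eq_bigl (fun v => v \in ~: K)) => [|v]; last by rewrite in_setC.
  suff closedC v w : v \in ~: K -> edge v w -> w \in ~: K.
    by move=> sum_deg cK /(_ closedC); lia.
  rewrite inE => vK vw; rewrite inE; apply: contra vK => wK.
  have dv : degree v = 1 by apply: (partner w); rewrite // edge_sym.
  rewrite inE dv eqxx; apply/existsP; exists w; rewrite vw.
  by move: wK; rewrite inE => /andP[].
pose B := [set v : G | 1 < degree v].
(* The enumeration order breaks the symmetry between the two ends of a K2-component. *)
pose first v := [exists w, edge v w && (enum_rank v < enum_rank w)].
have firstE v w : degree v = 1 -> edge v w -> first v = (enum_rank v < enum_rank w).
  move=> dv vw; apply/existsP/idP => [[u /andP[vu]]|lt_vw]; last by exists w; rewrite vw.
  by rewrite (degree1_uniq dv vw vu).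
pose half b := [set v in K | b == first v].
have domB b : domination_number G <= #|B| + #|half b|.
  apply: leq_trans (leq_card_setU _ _); apply: domination_number_le.
  apply/dominatingP => v; rewrite !in_setU negb_or => /andP[].
  rewrite inE -leqNgt => dv; have {}dv : degree v = 1 by have := pos v; lia.
  have /degree_gt0P[w vw] := pos v; have wv : edge w v by rewrite edge_sym.
  rewrite inE negb_and => vhalf; exists w => //; rewrite !in_setU inE.
  case: ltnP => //= dw; have {}dw : degree w = 1 by have := pos w; lia.
  have inK x y : degree x = 1 -> degree y = 1 -> edge x y -> x \in K.
    by move=> dx dy xy; rewrite inE dx eqxx; apply/existsP; exists y; rewrite xy dy.
  rewrite inE (inK w v) //= (firstE w v) //.
  move: vhalf; rewrite (inK v w) //= (firstE v w) //.
  have : enum_rank v != enum_rank w.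
    by rewrite (inj_eq enum_rank_inj); apply: contraTneq vw => ->; rewrite edge_irrefl.
  by rewrite -(inj_eq val_inj) neq_ltn; case: b; case: ltngtP.
have cards_half : #|half true| + #|half false| = #|K|.
  rewrite -(cardsID [set v | first v] K); congr (_ + _); apply: eq_card => v;
    by rewrite !inE; case: (first _); rewrite ?andbT ?andbF.
(* Adding the bounds for both halves spares a proof that they have the same size. *)
have := domB true; have := domB false; rewrite /B; lia.
Qed.

(* Colour the forest by adding leaves one at a time, giving each new leaf the
   colour that its neighbour does not see yet. *)
Lemma forest_colouring : exists f : G -> 'I_3,
  (forall v w, edge v w -> f v != f w) /\
  (forall v k, 1 < degree v -> k != f v -> exists2 w, edge v w & f w = k).
Proof.
suff [f [fne fsee]] : exists f : G -> 'I_3,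
    (forall v w, v \in [set: G] -> w \in [set: G] -> edge v w -> f v != f w) /\
    (forall v x y k, v \in [set: G] -> x \in [set: G] -> y \in [set: G] -> 
       edge v x -> edge v y -> x != y -> k != f v ->
       exists w, [/\ w \in [set: G], edge v w & f w = k]).
  exists f; split=> [v w|v k /degree_ge2P[x [y [vx vy xy]]] kv]; first exact: fne.
  by have [] := fsee v x y k; rewrite ?inE // => w [_]; exists w.
elim/forest_ind: [set: G] => [|A v vA low [f [fne fsee]]].
  by exists (fun=> ord0); split=> [x y|x y z k]; rewrite inE.
have third (a b : 'I_3) : exists2 k : 'I_3, k != a & k != b.
  case: (pickP [pred k : 'I_3 | (k != a) && (k != b)]) => [k /andP[]|no3].
    by exists k.
  have := no3 ord0; have := no3 (Ordinal (isT : 1 < 3)); have := no3 ord_max.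
  by case: a {no3} => [[|[|[|]]]] // ?; case: b => [[|[|[|]]]].
have only2 (a b k j : 'I_3) : a != b -> k != a -> k != b -> j != a -> j = k \/ j = b.
  rewrite -!(inj_eq val_inj) => ab ka kb ja.
  have [jk|jk] := eqVneq (val j) k; [left | right]; apply: val_inj => //=.
  by move: (ltn_ord a) (ltn_ord b) (ltn_ord k) (ltn_ord j) ab ka kb ja jk => /=; lia.
(* If the neighbour [u] of [v] has a neighbour [x] in [A], then [k] avoids [f u] and [f x], so [u]
   sees both other colours, at [v] and at [x]. Otherwise [k] need only avoid [f u]. *)
have [k good] : exists k, forall u, u \in A -> edge v u -> k != f u /\
    forall x j, x \in A -> edge u x -> j != f u ->
      j = k \/ exists2 w, w \in A & edge u w /\ f w = j.
  case: (pickP [pred w in A | edge v w]) => [u /andP[uA vu]|noN]; last first.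
    by exists ord0 => u uA vu; have := noN u; rewrite /= uA vu.
  have uniqu w : w \in A -> edge v w -> w = u.
    by move=> wA vw; apply: (card_le1_eqP low); rewrite inE ?wA ?uA.
  case: (pickP [pred x in A | edge u x]) => [x /andP[xA ux]|nox]; last first.
    have [k ku _] := third (f u) (f u); exists k => w wA /(uniqu w wA)->; split=> // x j xA ux.
    by have := nox x; rewrite /= xA ux.
  have [k ku kx] := third (f u) (f x); exists k => w wA /(uniqu w wA)->; split=> // _ j _ _ ju.
  have [|->] := only2 _ _ _ _ (fne u x uA xA ux) ku kx ju; first by left.
  by right; exists x.
have nv w : w \in A -> (w == v) = false by move=> wA; apply: contraNF vA => /eqP<-.
exists (fun w => if w == v then k else f w); split=> [x y|x y z j].
  rewrite !inE => /orP[/eqP->|xA] /orP[/eqP->|yA]; rewrite ?edge_irrefl ?eqxx ?nv //.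
  - by case/(good y yA).
  - by rewrite edge_sym eq_sym => /(good x xA)[].
  - exact: fne.
rewrite !inE => /orP[/eqP->|xA] yS zS xy xz yz; rewrite ?eqxx ?nv //.
  have inA w : (w == v) || (w \in A) -> edge v w -> w \in A.
    by case: eqP => [->|] //=; rewrite edge_irrefl.
  by case/eqP: yz; apply: (card_le1_eqP low); rewrite inE (xy, xz) andbT; apply: inA.
move=> jx.
have [vx|nvx] := boolP (edge v x).
  have [_ goodx] := good x xA vx.
  have [t tA xt] : exists2 t, t \in A & edge x t.
    case: (y =P v) yS => [Ey _|_ /= yA]; last by exists y.
    by exists z => //; move: zS; rewrite eq_sym -Ey in yz *; rewrite (negPf yz).
  have [->|[w wA [xw fw]]] := goodx t j tA xt jx.
    by exists v; rewrite !inE eqxx edge_sym.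
  by exists w; rewrite !inE wA orbT nv.
have inA w : (w == v) || (w \in A) -> edge x w -> w \in A.
  by case: eqP => [->|] //= _; rewrite edge_sym (negPf nvx).
have [w [wA xw fw]] := fsee x y z j xA (inA y yS xy) (inA z zS xz) xy xz yz jx.
by exists w; rewrite !inE wA orbT nv.
Qed.

(* The sets [{v | f v = i or v sees no colour i}], for the three colours [i] of
   [forest_colouring], dominate; each vertex lies in one of them, each leaf in two. *)
Lemma domination_number_third : (forall v : G, 0 < degree v) ->
  3 * domination_number G <= #|G| + #|[set v : G | degree v == 1]|.
Proof.
move=> pos; have [f [fne fsee]] := forest_colouring.
pose D i := [set v : G | (f v == i) || ~~ [exists w, edge v w && (f w == i)]].
have domD i : domination_number G <= #|D i|.
  apply/domination_number_le/dominatingP => v.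
  rewrite inE negb_or negbK => /andP[_ /existsP[w /andP[vw fw]]].
  by exists w => //; rewrite inE fw.
have leD v : \sum_(i < 3) (v \in D i) <= 1 + (degree v == 1).
  have -> : \sum_(i < 3) (v \in D i) = #|[set i | v \in D i]|.
    rewrite -sum1_card [RHS]big_mkcond; apply: eq_bigr => i _.
    by rewrite inE; case: (v \in _).
  have [dv|dv] := eqVneq (degree v) 1.
    have /degree_gt0P[w vw] := pos v.
    apply: (leq_trans (_ : _ <= #|~: [set f w]|)); last first.
      by have := cardsC [set f w]; rewrite cards1 card_ord; lia.
    apply/subset_leq_card/subsetP => i; rewrite !inE; case/orP=> [/eqP<-|].
      exact: fne.
    by apply: contra => /eqP->; apply/existsP; exists w; rewrite vw eqxx.
  rewrite addn0; apply: leq_trans (_ : #|[set f v]| <= 1); last by rewrite cards1.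
  apply/subset_leq_card/subsetP => i.
  rewrite !inE eq_sym => /orP[//|]; apply: contraR => iv.
  have [|w vw fw] := fsee v i _ iv; first by have := pos v; lia.
  by apply/existsP; exists w; rewrite vw fw eqxx.
have sumD : \sum_(i < 3) #|D i| <= #|G| + #|[set v : G | degree v == 1]|.
  have -> : #|G| + #|[set v : G | degree v == 1]| = \sum_(v : G) (1 + (degree v == 1)).
    rewrite big_split /= sum1_card; congr (_ + _); rewrite -sum1_card big_mkcond.
    by apply: eq_bigr => v _; rewrite inE; case: eqP.
  have cardD i : #|D i| = \sum_(v : G) (v \in D i).
    by rewrite -sum1_card big_mkcond; apply: eq_bigr => v _; case: (v \in _).
  rewrite (eq_bigr _ (fun i _ => cardD i)) exchange_big.
  by apply: leq_sum => v _; apply: leD.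
by move: sumD; rewrite !big_ord_recl big_ord0;
  have := domD ord0; have := domD (lift ord0 ord0); have := domD (lift ord0 (lift ord0 ord0)); lia.
Qed.

End UpperBounds.

(** * Adding an isolated vertex or a leaf *)

Section Extension.
Variables (G : sgraph) (o : option G).
Implicit Types (P : {set G}) (b : bool).

(* The new vertex [None] is isolated if [o = None], and is a leaf attached to [u]
   if [o = Some u]. *)
Definition extension_edge : rel (option G) := fun x y =>
  match x, y with
  | Some a, Some b => edge a b
  | Some a, None | None, Some a => o == Some a
  | None, None => false
  end.

Lemma extension_edge_sym : symmetric extension_edge.
Proof. by move=> [x|] [y|] //=; apply: edge_sym. Qed.

Lemma extension_edge_irrefl : irreflexive extension_edge.
Proof. by move=> [x|] //=; apply: edge_irrefl. Qed.

Definition extension := SGraph extension_edge_sym extension_edge_irrefl.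

Definition extension_set b P : {set extension} :=
  [set z : option G | if z is Some x then x \in P else b].

(** The new vertex has at most one neighbour, but on a cycle its predecessor and successor would be
    distinct; a cycle avoiding it comes from [G]. *)
Lemma extension_forest : is_forest G -> is_forest extension.
Proof.
move=> forestG s; have [inN|notN] := boolP (None \in s).
  case/rot_to: inN => i t Et; rewrite -(size_rot i) -(rot_ucycle i) {}Et /ucycle.
  case: t => [|x t] //=; case/lastP: t => [|t y] //= _.
  rewrite !rcons_path last_rcons mem_rcons !inE.
  case: x y => [x|] [y|] //=; rewrite ?andbF //.
  by case/and4P=> /and3P[/eqP-> _ /eqP[->]] _ /negP[]; rewrite eqxx.
have [t ->] : exists t : seq G, s = map Some t.
  elim: s notN => [|[x|] s IHs]; [by exists [::] | | by rewrite in_cons].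
  by rewrite in_cons => /IHs[t ->]; exists (x :: t).
rewrite size_map => /forestG cyc; case/andP => ct ut; apply: cyc.
rewrite /ucycle -(map_inj_uniq (@Some_inj _)) ut andbT.
by case: t ct {ut} => [|x t] //=; rewrite -map_rcons path_map.
Qed.

Lemma degree_extension_Some (x : G) :
  degree (Some x : extension) = degree x + (o == Some x).
Proof.
rewrite /degree.
have -> : [set w | edge (Some x : extension) w] =
    [set Some w | w in [set w | edge x w]] :|: (if o == Some x then [set None] else set0).
  apply/setP => -[w|]; rewrite !inE /=.
    rewrite mem_imset ?inE; last exact: Some_inj.
    by case: ifP; rewrite !inE ?orbF.
  have -> /= : None \in [set Some w | w in [set w | edge x w]] = false.
    by apply/imsetP => -[].
  by case: ifP; rewrite !inE.
rewrite cardsU card_imset; last exact: Some_inj.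
rewrite [_ :&: _](_ : _ = set0) ?cards0 ?subn0.
  by case: ifP; rewrite ?cards1 ?cards0.
apply/setP => -[w|]; rewrite !inE; first by case: ifP; rewrite !inE ?andbF.
by apply/andP => -[/imsetP[]].
Qed.

Lemma degree_extension_None : degree (None : extension) = (o != None).
Proof.
rewrite /degree; case Eo: o => [u|].
  apply/eqP/cards1P; exists (Some u); apply/setP => -[w|]; rewrite !inE //= Eo.
  by rewrite eq_sym.
by apply: eq_card0 => -[w|]; rewrite !inE //= Eo.
Qed.

(** Among old vertices, only the closed neighbourhood of the attachment vertex grows, and only by
    [None]. If [None] joins the packing, its own closed neighbourhood must miss all the others. *)
Lemma packing_extension b P : packing P ->
  (b -> forall u p, o = Some u -> p \in P -> ~~ ((u == p) || edge p u)) ->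
  packing (extension_set b P).
Proof.
move=> packP sepb [x|] [y|] w //; rewrite !inE.
- move=> xP yP; case: w => [w|] /=; first by move=> xw yw; rewrite (packP x y w).
  by move=> /eqP-> /eqP.
- move=> xP bT; case: w => [w|] /=.
    by move=> xw /eqP ow; have := sepb bT w x ow xP; rewrite xw.
  by move=> /eqP ox _; have := sepb bT x x ox xP; rewrite eqxx.
- move=> bT xP; case: w => [w|] /=.
    by move=> /eqP ow xw; have := sepb bT w y ow xP; rewrite xw.
  by move=> _ /eqP ox; have := sepb bT y y ox xP; rewrite eqxx.
Qed.

Lemma extension_profile b P :
  perm_eq [seq (degree v, v \in extension_set b P) | v : extension]
    ((o != None : nat, b) :: [seq (degree x + (o == Some x), x \in P) | x : G]).
Proof.
have perm_enum : perm_eq (enum extension) (None :: map Some (enum G)).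
  apply: uniq_perm; rewrite ?enum_uniq //=.
    rewrite map_inj_uniq ?enum_uniq; last exact: Some_inj.
    by rewrite andbT; apply/mapP => -[].
  move=> [x|]; rewrite mem_enum !inE //=.
  by rewrite mem_map ?mem_enum //; exact: Some_inj.
rewrite (perm_trans (perm_map _ perm_enum)) //= inE degree_extension_None -map_comp.
by rewrite perm_cons; apply/permP => a; congr (count a _); apply: eq_map => x;
  rewrite /= inE degree_extension_Some.
Qed.
End Extension.

(** * Degree profiles with a marked packing *)

Definition profile (G : sgraph) (P : {set G}) (s : seq (nat * bool)) : Prop :=
  [/\ is_forest G, packing P & perm_eq [seq (degree v, v \in P) | v : G] s].

(** Recording only pairs of degree and packing flag lets the constructions work on lists up to
    permutation, without naming vertices. *)
Definition realizable (s : seq (nat * bool)) : Prop :=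
  exists (G : sgraph) (P : {set G}), profile P s.

Lemma realizable_perm s t : perm_eq s t -> realizable s -> realizable t.
Proof.
move=> st [G [P [fG pP Ps]]]; exists G, P; split=> //; exact: perm_trans st.
Qed.

Lemma profile_isolated (G : sgraph) (P : {set G}) b s :
  profile P s -> profile (extension_set None b P) ((0, b) :: s).
Proof.
case=> fG pP Ps; split; [exact: extension_forest | exact: packing_extension | ].
apply: perm_trans (extension_profile None b P) _; rewrite perm_cons.
by congr (perm_eq _ s): Ps; apply: eq_map => x; rewrite addn0.
Qed.

Lemma profile_leaf (G : sgraph) (P : {set G}) (b : bool) (u : G) s :
  (b -> forall p, p \in P -> ~~ ((u == p) || edge p u)) ->
  profile P ((degree u, u \in P) :: s) ->
  profile (extension_set (Some u) b P) ((1, b) :: ((degree u).+1, u \in P) :: s).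
Proof.
move=> sepb [fG pP Ps]; split; first exact: extension_forest.
  by apply: packing_extension => // bT _ p [<-]; apply: sepb.
apply: perm_trans (extension_profile (Some u) b P) _; rewrite perm_cons.
have uE : u \in enum G by rewrite mem_enum.
apply: perm_trans (perm_map _ (perm_to_rem uE)) _.
rewrite /= eqxx addn1 perm_cons.
have nou : {in rem u (enum G), forall x, u == x = false}.
  by move=> x; rewrite mem_rem_uniq ?enum_uniq // !inE eq_sym => /andP[/negPf].
rewrite (@eq_in_map _ _ _ (fun x => (degree x, x \in P)) _).1 => [|x /nou /= xu]; last first.
  by rewrite (inj_eq (@Some_inj _)) xu addn0.
rewrite -(perm_cons (degree u, u \in P)); apply: perm_trans Ps.
by rewrite perm_sym; apply: (perm_map _ (perm_to_rem uE)).
Qed.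

Lemma profile_head (G : sgraph) (P : {set G}) a b s :
  profile P ((a, b) :: s) -> exists2 u : G, degree u = a & (u \in P) = b.
Proof.
case=> _ _ /perm_mem/(_ (a, b)); rewrite inE eqxx => /mapP[u _ [-> ->]].
by exists u.
Qed.

Lemma realizable_nil : realizable [::].
Proof.
have sym : @symmetric void [rel x y | false] by [].
have irr : @irreflexive void [rel x y | false] by [].
exists (SGraph sym irr), set0; split; [by case=> [|[]] | by move=> [] | ].
by rewrite /image_mem (size0nil (_ : size (enum _) = 0)) // -cardE card_void.
Qed.

Lemma realizable_isolated b s : realizable s -> realizable ((0, b) :: s).
Proof.
case=> G [P /(profile_isolated b) Ps].
by exists (extension None), (extension_set None b P).
Qed.

Lemma realizable_leaf a b s :
  realizable ((a, b) :: s) -> realizable ((a.+1, b) :: (1, false) :: s).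
Proof.
case=> G [P Ps]; have [u du uP] := profile_head Ps.
apply: (@realizable_perm ((1, false) :: (a.+1, b) :: s)).
  by rewrite -(perm_catCA [:: _] [:: _]).
exists (extension (Some u)), (extension_set (Some u) false P).
by rewrite -du -uP; apply: profile_leaf; rewrite ?du ?uP.
Qed.

(** A pendant path with two new vertices is attached to [u], and its end joins the packing. The end
    sees only the middle vertex, which is adjacent to no old packing vertex because [u] is
    unmarked. *)
Lemma realizable_corona a s :
  realizable ((a, false) :: s) ->
  realizable ((a.+1, false) :: (2, false) :: (1, true) :: s).
Proof.
case=> G [P Ps]; have [u du uP] := profile_head Ps.
pose G1 := extension (Some u); pose P1 := extension_set (Some u) false P.
pose G2 := @extension G1 (Some None); pose P2 := @extension_set G1 (Some None) true P1.
have Ps1 : profile P1 ((1, false) :: (a.+1, false) :: s).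
  by have := @profile_leaf G P false u s; rewrite du uP; apply.
have dN : degree (None : G1) = 1 by rewrite degree_extension_None.
have NP : (None \in P1) = false by rewrite inE.
have Ps2 : profile P2 ((1, true) :: (2, false) :: (a.+1, false) :: s).
  have := @profile_leaf G1 P1 true None ((a.+1, false) :: s); rewrite dN NP; apply=> //.
  move=> _ [p|]; rewrite !inE //=.
  by move=> pP; apply: contraFN uP => /eqP[->].
have : realizable ((1, true) :: (2, false) :: (a.+1, false) :: s) by exists G2, P2.
by apply: realizable_perm; apply/permP => f /=; lia.
Qed.

(** * Operations on degree sequences and the packings they gain *)

Definition packable (d : seq nat) (k : nat) : Prop :=
  exists s, [/\ realizable s, perm_eq (unzip1 s) d & count snd s = k].

Lemma packable_perm d e k : perm_eq d e -> packable d k -> packable e k.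
Proof. by move=> de [s [rs sd cs]]; exists s; split=> //; apply: perm_trans de. Qed.

Lemma packable_forest d k : packable d k ->
  exists2 F : sgraph, forest_realization d F & exists2 P : {set F}, packing P & #|P| = k.
Proof.
case=> s [[G [P [fG pP Ps]]] sd cs]; exists G; last exists P => //.
  split=> //; apply: perm_trans sd.
  rewrite [X in perm_eq X](_ : _ = unzip1 [seq (degree v, v \in P) | v : G]).
    exact: perm_map.
  by rewrite /unzip1 /image_mem -map_comp.
by rewrite -cs -(permP Ps) count_map -sum1_card -sum1_count big_enum_cond.
Qed.

Lemma packable_edge d k : packable d k -> packable (1 :: 1 :: d) k.+1.
Proof.
move=> [s [rs sd cs]]; exists ((1, true) :: (1, false) :: s); split=> //=.
- exact/realizable_leaf/realizable_isolated.
- by rewrite !perm_cons.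
- by rewrite cs.
Qed.

(** Attaching a pendant path to the unmarked end of a K2 puts both leaves of the resulting P4 into
    the packing. *)
Lemma packable_P4 d k : packable d k -> packable (2 :: 2 :: 1 :: 1 :: d) k.+2.
Proof.
move=> [s [rs sd cs]].
exists ((2, false) :: (2, false) :: (1, true) :: (1, true) :: s); split=> /=.
- apply/realizable_corona/(@realizable_perm [:: (1, true), (1, false) & s]).
    by rewrite -(perm_catCA [:: _] [:: _]).
  exact/realizable_leaf/realizable_isolated.
- by rewrite !perm_cons.
- by rewrite cs.
Qed.

Lemma packable_leaf d k : 1 \in d -> packable d k -> exists b s,
  [/\ realizable ((1, b) :: s), perm_eq (1 :: unzip1 s) d & b + count snd s = k].
Proof.
move=> d1 [s [rs sd cs]].
have /mapP[[a b] abs /= Ea] : 1 \in unzip1 s by rewrite (perm_mem sd).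
rewrite -Ea in abs; have sE := perm_to_rem abs.
exists b, (rem (1, b) s); split; first exact: realizable_perm rs.
  by apply: perm_trans sd; rewrite perm_sym; apply: (perm_map fst sE).
by rewrite -cs (permP sE).
Qed.

(** Prolonging the tree at a leaf changes the degrees exactly as subdividing an edge does. *)
Lemma packable_subdivide d k : 1 \in d -> packable d k -> packable (2 :: d) k.
Proof.
move=> d1 /(packable_leaf d1)[b [s [rs sd cs]]].
exists ((2, b) :: (1, false) :: s); split=> //; first exact: realizable_leaf.
by rewrite /= perm_cons.
Qed.

(** A leaf is prolonged by three vertices, the last of which joins the packing. The first new vertex
    is unmarked, so the corona step applies whatever the flag of the old leaf. *)
Lemma packable_subdivide3 d k :
  1 \in d -> packable d k -> packable (2 :: 2 :: 2 :: d) k.+1.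
Proof.
move=> d1 /(packable_leaf d1)[b [s [rs sd cs]]].
exists ((2, false) :: (2, false) :: (1, true) :: (2, b) :: s); split.
- apply/realizable_corona/(@realizable_perm [:: (2, b), (1, false) & s]).
    by rewrite -(perm_catCA [:: _] [:: _]).
  exact: realizable_leaf.
- by rewrite /= !perm_cons -(perm_catCA [:: _] [:: _]) perm_cons.
- by rewrite /=; lia.
Qed.

Lemma packable_subdivisions d k r :
  1 \in d -> packable d k -> packable (nseq r 2 ++ d) (k + r %/ 3).
Proof.
move=> d1 pd; elim/ltn_ind: r => -[|[|[|r]]] IHr.
- by rewrite div0n addn0.
- by rewrite divn_small ?addn0 //; apply: packable_subdivide.
- rewrite divn_small ?addn0 //; apply: packable_subdivide; first by rewrite inE d1.
  exact: packable_subdivide.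
- have -> : k + r.+3 %/ 3 = (k + r %/ 3).+1 by lia.
  by apply: packable_subdivide3; [rewrite mem_cat d1 orbT | apply: IHr; lia].
Qed.

(** * Trees in which each inner vertex has its own leaf *)

Lemma sumn_ge k D : all (leq k) D -> k * size D <= sumn D.
Proof. by elim: D => [|x D IHD] /=; [rewrite muln0 | case/andP=> kx /IHD; lia]. Qed.

Lemma sumn_le k D : all (geq k) D -> sumn D <= k * size D.
Proof. by elim: D => //= x D IHD /andP[kx /IHD]; move: kx => /=; lia. Qed.

(** Entrywise, x + [x = 2] is at least 3; hence a small degree sum forces many entries 2. *)
Lemma sumn_count_two D : all (leq 2) D -> 3 * size D <= sumn D + count_mem 2 D.
Proof. by elim: D => //= x D IHD /andP[kx /IHD]; case: eqP; lia. Qed.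

Lemma extract_nseq (x : nat) j D :
  j <= count_mem x D -> exists D', perm_eq D (nseq j x ++ D').
Proof.
elim: j => [|j IHj] jD; first by exists D.
have [D' DD'] := IHj (ltnW jD).
have xD' : x \in D'.
  move: jD; rewrite (permP DD') count_cat count_nseq /= eqxx mul1n -[X in X < _]addn0 ltn_add2l.
  by rewrite -has_count has_pred1.
exists (rem x D'); apply: perm_trans DD' _; rewrite -addn1 nseqD -catA perm_cat2l.
exact: perm_to_rem.
Qed.

(* Degree profile of a tree with inner degrees [D] and [L] leaves in which each
   inner vertex has a leaf belonging to the packing. *)
Definition leafy (D : seq nat) (L : nat) : seq (nat * bool) :=
  [seq (a, false) | a <- D] ++ nseq (size D) (1, true) ++ nseq (L - size D) (1, false).

Lemma leafy_perm D E L : perm_eq D E -> realizable (leafy D L) -> realizable (leafy E L).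
Proof.
move=> DE; apply: realizable_perm; rewrite /leafy (perm_size DE) perm_cat2r.
exact: perm_map.
Qed.

Lemma leafy_corona a D L : realizable (leafy (a :: D) L) ->
  realizable (leafy (a.+1 :: 2 :: D) L.+1).
Proof.
move/realizable_corona; apply: realizable_perm; apply/permP => f.
by rewrite /leafy /= !count_cat /= !count_cat /= !count_nseq -!/(map _ _); lia.
Qed.

Lemma leafy_leaf a D L : size D < L -> realizable (leafy (a :: D) L) ->
  realizable (leafy (a.+1 :: D) L.+1).
Proof.
move=> DL /realizable_leaf; apply: realizable_perm; apply/permP => f.
by rewrite /leafy /= !count_cat /= !count_cat /= !count_nseq -!/(map _ _) subSn // mulnS; lia.
Qed.

(* The case [D = [:: 1]] is the base K2 of the induction. *)
Lemma realizable_leafy D L :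
  0 < size D -> (size D == 1) && (0 < sumn D) || all (leq 2) D ->
  L + 2 * size D = sumn D + 2 -> size D <= L -> realizable (leafy D L).
Proof.
have [N] := ubnP (sumn D); elim: N D L => // N IHN [|a D] L //= sumN _.
(* A single inner vertex gives a star, stripped of its leaves down to K2. *)
case: D sumN => [|b D] sumN Dge eL DL.
  case: a => [|[|a]] in sumN Dge eL *; [by [] | | ].
    have -> : L = 1 by move: eL => /=; lia.
    apply/(@realizable_perm [:: (1, true); (1, false)]) => //.
    exact/realizable_leaf/realizable_isolated/realizable_nil.
  case: L => [|L] in eL DL *; first by move: eL => /=; lia.
  by apply: leafy_leaf; [|apply: IHN]; move: eL sumN => /=; lia.
have {}Dge : all (leq 2) [:: a, b & D] by move: Dge; rewrite /=.
(* Without an entry 2 all inner degrees are at least 3, so [L] exceeds the number of inner vertices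
   and a surplus leaf can be removed. *)
have [D2|noD2] := boolP (2 \in [:: a, b & D]); last first.
  have {}Dge : all (leq 3) [:: a, b & D].
    apply/allP => x xD; have := allP Dge x xD; rewrite leq_eqVlt => /orP[/eqP Ex|//].
    by rewrite Ex xD in noD2.
  have := sumn_ge Dge; move=> {noD2}.
  case: L a => [|L] [|a] // in sumN Dge eL DL *; move: Dge => //=.
  move=> /and3P[a3 b3 D3] sge; apply: leafy_leaf => /=; first by move: eL => /=; lia.
  apply: IHN => /=; try by move: eL sumN => /=; lia.
  by apply/and3P; split; [lia | lia | apply: sub_all D3 => x; apply: ltnW].
have DE := perm_to_rem D2; set E := rem 2 _ in DE.
have [sE sumE] := (perm_size DE, perm_sumn DE); move: sE sumE => /= sE sumE.
move: Dge; rewrite (perm_all _ DE) /= => Ege.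
(* A degree-2 vertex and its leaf are removed from a neighbour [x], whose degree must stay at least
   2 unless K2 remains. If all degrees are 2, then [L] is 2, so there are only two inner
   vertices. *)
have [x [E' [EE' xge]]] : exists x E', perm_eq E (x :: E') /\ (2 < x \/ E' = [::]).
  have [Ele|/allPn[x xE xge]] := boolP (all (geq 2) E); last first.
    exists x, (rem x E); split; first exact: perm_to_rem.
    by left; move: xge => /=; lia.
  have := sumn_le Ele; case: E {DE Ege Ele} sE sumE => [|x [|y E]] //= sE sumE le.
    by exists x, [::]; split; last right.
  by move: eL DL => /=; lia.
have [sE' sumE'] := (perm_size EE', perm_sumn EE'); move: sE' sumE' => /= sE' sumE'.
move: Ege; rewrite (perm_all _ EE') /= => /andP[x2 E'ge].
apply: (@leafy_perm (x :: 2 :: E')).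
  by apply/permP => f; rewrite (permP DE) /= (permP EE') /=; lia.
case: L x => [|L] [|x] // in eL DL xge sumE' x2 EE' *; apply: leafy_corona.
apply: IHN => //=; try by move: eL DL sumN => /=; lia.
case: xge => [x3|->]; last by rewrite /=; lia.
by rewrite E'ge; lia.
Qed.

Lemma packable_leafy D L :
  0 < size D -> all (leq 2) D -> L + 2 * size D = sumn D + 2 -> size D <= L ->
  packable (D ++ nseq L 1) (size D).
Proof.
move=> D0 Dge eL DL; exists (leafy D L); split.
- by apply: realizable_leafy; rewrite ?Dge ?orbT.
- rewrite /unzip1 !map_cat -map_comp map_id !map_nseq /= -nseqD subnKC //.
- by rewrite !count_cat !count_nseq count_map /= (eq_count (a2 := pred0)) // count_pred0; lia.
Qed.

(** * Assembling forests with several components *)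

Lemma packable_edges d k j : packable d k -> packable (nseq (2 * j) 1 ++ d) (k + j).
Proof.
move=> pd; elim: j => [|j IHj]; first by rewrite addn0.
by rewrite mulnS addnS; apply: packable_edge.
Qed.

Lemma packable_P4s d k j :
  packable d k -> packable (nseq (2 * j) 2 ++ nseq (2 * j) 1 ++ d) (k + 2 * j).
Proof.
move=> pd; elim: j => [|j IHj]; first by rewrite addn0.
have -> : k + 2 * j.+1 = (k + 2 * j).+2 by lia.
rewrite mulnS.
apply: packable_perm (packable_P4 IHj); apply/permP => f.
by rewrite /= !count_cat /= !count_cat !count_nseq; lia.
Qed.

(* At least [2 * c + (size D - L)] of the inner degrees are 2: spend [2 * (c - 1)]
   of them on P4-components and [size D - L] of them on subdividing an edge. *)
Lemma packable_few_leaves D L c :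
  all (leq 2) D -> 0 < c -> L <= size D -> sumn D + 2 * c = 2 * size D + L ->
  packable (D ++ nseq L 1) (L + (size D - L) %/ 3).
Proof.
move=> Dge c0 LD sumD; have two := sumn_count_two Dge.
(* [sumn_count_two] provides at least 2 * c + (size D - L) entries 2. *)
have [|D' DD'] := @extract_nseq 2 (2 * c.-1 + (size D - L)) D; first by lia.
have sizeD' : size D = 2 * c.-1 + (size D - L) + size D'.
  by rewrite {1}(perm_size DD') size_cat size_nseq.
have sumD' : sumn D = 2 * (2 * c.-1 + (size D - L)) + sumn D'.
  by rewrite (perm_sumn DD') sumn_cat sumn_nseq.
have D'ge : all (leq 2) D' by move: Dge; rewrite (perm_all _ DD') all_cat => /andP[].
have sumD_ge := sumn_ge Dge.
(* The remaining tree has as many inner vertices as leaves, the extreme case of [packable_leafy]. *)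
have DL : size D' = L - 2 * c.-1 by lia.
have L1 : 0 < L - 2 * c.-1 by lia.
have pt : packable (D' ++ nseq (L - 2 * c.-1) 1) (L - 2 * c.-1).
  by rewrite -{2}DL; apply: packable_leafy => //; lia.
have /(packable_subdivisions (size D - L)) := packable_P4s c.-1 pt.
have -> : L - 2 * c.-1 + 2 * c.-1 = L by lia.
rewrite !mem_cat !mem_nseq L1 eqxx !orbT => /(_ isT).
apply: packable_perm; apply/permP => f; rewrite !count_cat (permP DD') !count_cat !count_nseq.
have {2}-> : L = (L - 2 * c.-1) + 2 * c.-1 by lia.
by lia.
Qed.

(** * Comparing both bounds for a given degree sequence *)

Section Realization.
Variables (G : sgraph) (d : seq nat).
Hypothesis degd : perm_eq [seq degree v | v : G] d.

Lemma card_degree (a : pred nat) : #|[set v : G | a (degree v)]| = count a d.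
Proof.
rewrite -(permP degd) count_map -sum1_card -sum1_count big_enum_cond.
by apply: eq_bigl => v; rewrite inE.
Qed.

Lemma sum_degree : \sum_(v : G) degree v = sumn d.
Proof. by rewrite -(perm_sumn degd) sumnE big_image. Qed.

Lemma card_realization : #|G| = size d.
Proof. by rewrite -(perm_size degd) size_image. Qed.

End Realization.

Lemma perm_inner_leaves d : all (leq 1) d ->
  perm_eq d (filter (leq 2) d ++ nseq (num_eq 1 d) 1).
Proof.
move=> pos; rewrite perm_sym; apply: perm_trans (permEl (perm_filterC (leq 2) d)).
rewrite perm_cat2l.
rewrite (_ : filter (predC _) d = nseq (num_eq 1 d) 1) //.
rewrite /num_eq (@eq_in_count _ _ (predC (leq 2))) => [|x /(allP pos)] /=; last first.
  by case: x => [|[|]].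
rewrite -size_filter; apply/all_pred1P/allP => x; rewrite mem_filter => /andP[/= x2].
by move/(allP pos); case: x x2 => [|[|]].
Qed.

Theorem theorem1 (n c : nat) (d : n.-tuple nat)
  (d_noninc : sorted geq d)
  (d_pos : forall x, x \in d -> 0 < x)
  (d1_ge2 : 2 <= nth 0 d 0)
  (c_pos : 0 < c)
  (d_sum : \sum_(i < n) tnth d i + 2 * c = 2 * n) :
  is_gamma_max_forest d
    (if num_ge 2 d < num_eq 1 d then
       if c - 1 < ceil_div (num_eq 1 d - num_ge 2 d) 2
       then n - num_eq 1 d + c - 1
       else n %/ 2
     else ceil_div (n + num_eq 1 d - 2) 3).
Proof.
set value := (if _ then _ else _).
have pos : all (leq 1) d by apply/allP.
have {}d_sum : sumn d + 2 * c = 2 * n by rewrite sumnE big_tuple.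
pose D := filter (leq 2) d; have Dge : all (leq 2) D by apply: filter_all.
have perm_d := perm_inner_leaves pos; rewrite -/D in perm_d.
have cardD : num_ge 2 d = size D by rewrite size_filter.
have n_eq : n = size D + num_eq 1 d.
  by rewrite -{1}(size_tuple d) (perm_size perm_d) size_cat size_nseq.
have sum_eq : sumn d = sumn D + num_eq 1 d.
  by rewrite {1}(perm_sumn perm_d) sumn_cat sumn_nseq mul1n.
have inner : has (leq 2) d.
  by apply/hasP; exists (nth 0 d 0) => //; apply: mem_nth; case: (tval d) d1_ge2.
have D_pos : 0 < size D by rewrite size_filter -has_count.
have sumD_ge := sumn_ge Dge.
have pack : packable d value.
  rewrite perm_sym in perm_d; apply: packable_perm perm_d _.
  move: cardD n_eq sum_eq; rewrite /value /ceil_div.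
  set L := num_eq 1 d; set m := num_ge 2 d => cardD n_eq sum_eq.
  have edges j k : 2 * j <= L -> packable (D ++ nseq (L - 2 * j) 1) k ->
      packable (D ++ nseq L 1) (k + j).
    move=> jL /(packable_edges j); apply: packable_perm.
    by rewrite -{2}(subnKC jL) nseqD perm_catCA perm_refl.
  case: ltnP => [mL|Lm]; first case: ltnP => cL.
  (* After c - 1 K2-components, at least [m] leaves remain for one tree. *)
  - have -> : n - L + c - 1 = size D + (c - 1) by lia.
    by apply: edges; [|apply: packable_leafy]; lia.
  (* With [h] K2-components, [m] or m - 1 leaves remain, so the quotient by 3 vanishes; the other c
     - h components come from [packable_few_leaves]. *)
  - set h := (L - m + 1) %/ 2.
    have -> : n %/ 2 = L - 2 * h + (size D - (L - 2 * h)) %/ 3 + h by lia.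
    by apply: edges; [|apply: (packable_few_leaves (c := c - h))]; lia.
  (* The 2 added by [ceil_div] cancels the 2 subtracted, leaving the floor of (m + 2 * L) / 3. *)
  - have -> : (n + L - 2 + 2) %/ 3 = L + (size D - L) %/ 3 by lia.
    by apply: (packable_few_leaves (c := c)); lia.
have upper F : forest_realization d F -> domination_number F <= value.
  case=> fF degF; have cardF := card_realization degF; have sumF := sum_degree degF.
  have degF_pos (v : F) : 0 < degree v.
    by apply: (allP pos); rewrite -(perm_mem degF) image_f.
  have innerF : exists v : F, 1 < degree v.
    have [x xd x2] := hasP inner; move: xd; rewrite -(perm_mem degF).
    by case/imageP=> v _ Ex; exists v; rewrite -Ex.
  have half := domination_number_half degF_pos.
  have third := domination_number_third fF degF_pos.
  have := domination_number_inner (c := c) fF degF_pos innerF.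
  rewrite sumF (card_degree degF (leq 2)) -[count _ _]/(num_ge 2 d).
  move: third; rewrite (card_degree degF (pred1 1)) -[count _ _]/(num_eq 1 d).
  move: half; rewrite cardF size_tuple /value /ceil_div => half third /(_ d_sum).
  (* The three cases follow from the inner-vertex bound, [half] and [third], respectively. *)
  by case: ltnP => ?; [case: ltnP => ?|]; lia.
split=> //; have [F rF [P packP cP]] := packable_forest pack; exists F => //.
by apply/eqP; rewrite eqn_leq upper // -cP packing_le_domination_number.
Qed.
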